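(* Let $\Omega\subset\mathbb{R}^n$ be a nonempty open set, let $\mathcal{R}$ be a regular set of sequences and let $M=(M_p)_{p\in\mathbb{Z}_+}$ be a weight sequence as in the context. Then $\mathcal{G}^{M,\mathcal{R}}(\Omega)$ is a differential subalgebra of the Colombeau algebra $\mathcal{G}(\Omega)$.
   Context: $\mathbb{Z}_+=\{0,1,2,\dots\}$, $\mathbb{R}_+=[0,\infty)$. Colombeau algebra: $\mathcal{X}(\Omega)$ is the set of families $(u_\varepsilon)_\varepsilon\in C^\infty(\Omega)^{]0,1]}$ such that for every compact $K\subset\Omega$ and every $\alpha\in\mathbb{Z}_+^n$ there are $m\in\mathbb{Z}_+$, $C>0$, $\eta\in\,]0,1]$ with $\sup_{K}|\partial^\alpha u_\varepsilon|\le C\varepsilon^{-m}$ for all $\varepsilon\in\,]0,\eta]$. $\mathcal{N}(\Omega)$ is the set of $(u_\varepsilon)_\varepsilon\in\mathcal{X}(\Omega)$ such that for every compact $K\subset\Omega$, every $\alpha$ and every $m\in\mathbb{Z}_+$ there are $C>0$, $\eta\in\,]0,1]$ with $\sup_{K}|\partial^\alpha u_\varepsilon|\le C\varepsilon^{m}$ for all $\varepsilon\in\,]0,\eta]$. $\mathcal{G}(\Omega)=\mathcal{X}(\Omega)/\mathcal{N}(\Omega)$, a differential algebra with operations and derivatives defined on representatives. Regular set: a nonempty subset $\mathcal{R}\subset\mathbb{R}_+^{\mathbb{Z}_+}$ such that (R1) for all $N\in\mathcal{R}$ and $(k,k')\in\mathbb{Z}_+^2$ there is $N'\in\mathcal{R}$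 with $N_{m+k}+k'\le N'_m$ for all $m$; (R2) for all $N,N'\in\mathcal{R}$ there is $N''\in\mathcal{R}$ with $\max(N_m,N'_m)\le N''_m$ for all $m$; (R3) for all $N,N'\in\mathcal{R}$ there is $N''\in\mathcal{R}$ with $N_{l_1}+N'_{l_2}\le N''_{l_1+l_2}$ for all $l_1,l_2\in\mathbb{Z}_+$. Weight sequence: positive numbers $(M_p)_{p\in\mathbb{Z}_+}$ with $M_0=1$, (H1) $M_p^2\le M_{p-1}M_{p+1}$ for $p\ge1$, (H2) there are $A,H>0$ with $M_p\le AH^pM_qM_{p-q}$ for all $p\ge q$, (H3)$'$ $\sum_{p\ge1}M_{p-1}/M_p<\infty$. Ultraregular generalized functions: $\mathcal{X}^{M,\mathcal{R}}(\Omega)$ is the set of $(f_\varepsilon)_\varepsilon\in C^\infty(\Omega)^{]0,1]}$ such that for every compact $K\subset\Omega$ there are $N\in\mathcal{R}$, $C>0$, $\varepsilon_0\in\,]0,1]$ with $\sup_{K}|\partial^\alpha f_\varepsilon|\le C^{|\alpha|+1}M_{|\alpha|}\varepsilon^{-N_{|\alpha|}}$ for all $\alpha\in\mathbb{Z}_+^n$ and all $\varepsilon\le\varepsilon_0$. $\mathcal{N}^{M,\mathcal{R}}(\Omega)=\mathcal{N}(\Omega)\cap\mathcal{X}^{M,\mathcal{R}}(\Omega)$ and $\mathcal{G}^{M,\mathcal{R}}(\Omega)=\mathcal{X}^{M,\mathcal{R}}(\Omega)/\mathcal{N}^{M,\mathcal{R}}(\Omega)$, regarded inside $\mathcal{G}(\Omega)$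 via the map induced by the inclusion $\mathcal{X}^{M,\mathcal{R}}(\Omega)\subset\mathcal{X}(\Omega)$. *)

(* Defs.v *)
From HB Require Import structures.
From mathcomp Require Import all_boot all_order all_algebra.
From mathcomp Require Import all_classical all_reals all_analysis.
From mathcomp Require Import complex.
From mathcomp Require Import ring lra.
Set Implicit Arguments.
Unset Strict Implicit.
Unset Printing Implicit Defensive.
Import Order.TTheory GRing.Theory Num.Theory.
Import numFieldNormedType.Exports.
Local Open Scope classical_set_scope.
Local Open Scope ring_scope.
Local Open Scope complex_scope.

(* Nonemptiness of Omega is what makes the quotient algebra below nontrivial
   (1 != 0), as the library's algebra structures require. *)
Record open_domain (R : realType) (n : nat) := Domain {
  dset :> set 'rV[R]_n ;
  domain_open : open dset ;
  domain_nonempty : dset !=set0 }.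

Section RealFunctions.
Context {R : realType} {n : nat} {Omega : open_domain R n}.
Implicit Types (f g : Omega -> R) (j : 'I_n) (x : Omega).

Definition basis_vec j : 'rV[R]_n := delta_mx 0 j.

(* Functions live on the subtype Omega itself.  They are extended by 0 only to
   apply the directional derivative of the ambient space at points of Omega;
   since Omega is open, the value there does not depend on the extension. *)
Definition ext0 f (y : 'rV[R]_n) : R := oapp f 0 (insub y).

Definition rpartial j f x : R := 'D_(basis_vec j) (ext0 f) (\val x).

(* C^k on Omega: all iterated partial derivatives of order <= k exist and are
   continuous (for the topology induced on Omega). *)
Fixpoint Ck (k : nat) f : Prop :=
  if k is k'.+1 then
    continuous f /\
    forall j, (forall x, derivable (ext0 f) (\val x) (basis_vec j)) /\
              Ck k' (rpartial j f)
  else continuous f.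

Lemma ext0E f x : ext0 f (\val x) = f x.
Proof. by rewrite /ext0 valK. Qed.

Lemma continuous_ball f x (e : R) : continuous f -> 0 < e ->
  exists2 d, 0 < d & forall y, ball (\val x) d (\val y) -> `|f x - f y| < e.
Proof.
move=> fc e0.
have /cvgrPdist_lt /(_ e e0) := fc x.
by move=> /nbhs_ballP[d /= d0 dP]; exists d => // y xy; apply: dP.
Qed.

Lemma near_domain x : \forall y \near \val x, dset Omega y.
Proof.
by apply: (open_nbhs_nbhs (conj (@domain_open _ _ Omega) _)); exact: set_valP.
Qed.

Lemma ext0_add f g : ext0 (f + g) = ext0 f + ext0 g.
Proof.
by apply/funext => y; rewrite /ext0 !fctE; case: insub => //=; rewrite addr0.
Qed.

Lemma ext0_opp f : ext0 (- f) = - ext0 f.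
Proof.
by apply/funext => y; rewrite /ext0 !fctE; case: insub => //=; rewrite oppr0.
Qed.

Lemma ext0_mul f g : ext0 (f * g) = ext0 f * ext0 g.
Proof.
by apply/funext => y; rewrite /ext0 !fctE; case: insub => //=; rewrite mulr0.
Qed.

Lemma ext0_near_cst (c : R) x :
  \forall y \near \val x, (cst c : _ -> R) y = ext0 (cst c) y.
Proof.
apply: filterS (near_domain x) => y Oy.
by rewrite /ext0 insubT ?inE.
Qed.

Lemma Ck_continuous k f : Ck k f -> continuous f.
Proof. by case: k => // k []. Qed.

Lemma CkS k f : Ck k.+1 f -> Ck k f.
Proof.
elim: k f => [|k IH] f; first by case.
by move=> [fc fd]; split=> // j; have [fdj /IH] := fd j.
Qed.

Lemma rpartial_add j f g : Ck 1 f -> Ck 1 g ->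
  rpartial j (f + g) = rpartial j f + rpartial j g.
Proof.
move=> [_ /(_ j)[fd _]] [_ /(_ j)[gd _]].
by apply/funext => x; rewrite /rpartial ext0_add deriveD.
Qed.

Lemma rpartial_opp j f : Ck 1 f -> rpartial j (- f) = - rpartial j f.
Proof.
move=> [_ /(_ j)[fd _]].
by apply/funext => x; rewrite /rpartial ext0_opp deriveN.
Qed.

Lemma rpartial_mul j f g : Ck 1 f -> Ck 1 g ->
  rpartial j (f * g) = rpartial j f * g + f * rpartial j g.
Proof.
move=> [_ /(_ j)[fd _]] [_ /(_ j)[gd _]].
apply/funext => x; rewrite /rpartial ext0_mul deriveM//.
rewrite !ext0E [RHS]addrC; congr (_ + _).
by rewrite fctE [RHS]mulrC.
Qed.

Lemma rpartial_cst j (c : R) : rpartial j (cst c) = cst 0.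
Proof.
apply/funext => x; rewrite /rpartial.
by rewrite -(near_eq_derive _ (ext0_near_cst c x)) derive_cst.
Qed.

Lemma CkW k l f : (k <= l)%N -> Ck l f -> Ck k f.
Proof.
move=> kl; rewrite -(subnK kl); elim: (l - k)%N => // m IH.
by rewrite addSn => /CkS.
Qed.

Lemma Ck_add k f g : Ck k f -> Ck k g -> Ck k (f + g).
Proof.
elim: k f g => [|k IH] f g.
  by move=> fc gc x; apply: continuousD; [exact: fc|exact: gc].
move=> fC gC; have [fc fd] := fC; have [gc gd] := gC.
split=> [|j]; first by move=> x; apply: continuousD; [exact: fc|exact: gc].
have [fj fCj] := fd j; have [gj gCj] := gd j; split=> [x|].
  by rewrite ext0_add; exact: derivableD.
rewrite rpartial_add; [exact: IH|exact: (@CkW _ k.+1)..].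
Qed.

Lemma Ck_opp k f : Ck k f -> Ck k (- f).
Proof.
elim: k f => [|k IH] f /=; first by move=> fc x; apply: continuousN; exact: fc.
move=> fC; have [fc fd] := fC; split=> [|j]; first by move=> x; apply: continuousN; exact: fc.
have [fj fCj] := fd j; split=> [x|].
  by rewrite ext0_opp; exact: derivableN.
by rewrite rpartial_opp; [exact: IH|exact: (@CkW _ k.+1)].
Qed.

Lemma Ck_mul k f g : Ck k f -> Ck k g -> Ck k (f * g).
Proof.
elim: k f g => [|k IH] f g; first by move=> fc gc x; apply: continuousM; [exact: fc|exact: gc].
move=> fC gC; have [fc fd] := fC; have [gc gd] := gC.
split=> [|j]; first by move=> x; apply: continuousM; [exact: fc|exact: gc].
have [fj fCj] := fd j; have [gj gCj] := gd j; split=> [x|].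
  by rewrite ext0_mul; exact: derivableM.
rewrite rpartial_mul; [|exact: (@CkW _ k.+1)..].
by apply: Ck_add; apply: IH => //; exact: CkS.
Qed.

Lemma Ck_cst k (c : R) : Ck k (cst c).
Proof.
elim: k c => [|k IH] c; first by move=> x; exact: cst_continuous.
split=> [|j]; first by move=> x; exact: cst_continuous.
split=> [x|]; last by rewrite rpartial_cst.
apply: (near_eq_derivable (ext0_near_cst c x)); exact: derivable_cst.
Qed.

End RealFunctions.

Section Schwarz.
Context {R : realType} {n : nat}.
Implicit Types (V : 'rV[R]_n) (F : 'rV[R]_n -> R).

Lemma line_derivable F y v s : derivable F (y + s *: v) v ->
  is_derive s 1 (fun t : R => F (y + t *: v)) ('D_v F (y + s *: v)).
Proof.
move=> dF.
have E : (fun h : R => h^-1 *: (((fun t : R => F (y + t *: v)) \o shift s) (h *: 1)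
                            - F (y + s *: v))) =
       (fun h => h^-1 *: ((F \o shift (y + s *: v)) (h *: v) - F (y + s *: v))).
  apply/funext => h /=; congr (_ *: (F _ - _)).
  by rewrite [h *: 1]mulr1 scalerDl addrCA.
by split; rewrite /derivable /derive E.
Qed.

Lemma line_MVT F y v (h : R) : 0 < h ->
  (forall s, 0 <= s <= h -> derivable F (y + s *: v) v) ->
  exists2 s, 0 < s < h & F (y + h *: v) - F y = h * 'D_v F (y + s *: v).
Proof.
move=> h0 dF.
have id1 s : 0 <= s <= h -> is_derive s 1 (fun t : R => F (y + t *: v)) ('D_v F (y + s *: v)).
  by move=> /dF; exact: line_derivable.
have [||s] := @MVT R (fun t => F (y + t *: v)) (fun s => 'D_v F (y + s *: v)) 0 h h0.
- move=> s; rewrite in_itv/= => /andP[s0 s1].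
  by apply: id1; rewrite !ltW.
- apply: derivable_within_continuous => s; rewrite in_itv/= => sh.
  by have [] := id1 s sh.
- rewrite in_itv/= => sh; rewrite scale0r addr0 subr0 => E.
  by exists s => //; rewrite E mulrC.
Qed.

Lemma growth_shiftE F w y v :
  (fun h : R => h^-1 *: (((fun z => F (z + w)) \o shift y) (h *: v) - F (y + w))) =
  (fun h => h^-1 *: ((F \o shift (y + w)) (h *: v) - F (y + w))).
Proof. by apply/funext => h /=; rewrite addrA. Qed.

Lemma derive_shiftE F w y v : 'D_v (fun z => F (z + w)) y = 'D_v F (y + w).
Proof. by rewrite /derive growth_shiftE. Qed.

Lemma derivable_shiftE F w y v :
  derivable F (y + w) v -> derivable (fun z => F (z + w)) y v.
Proof. by rewrite /derivable growth_shiftE. Qed.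

Context {Omega : open_domain R n}.
Implicit Types (f : Omega -> R) (x : Omega).

Lemma second_difference f (x : Omega) (i j : 'I_n) (h : R) : Ck 2 f -> 0 < h ->
  (forall s t, 0 <= s <= h -> 0 <= t <= h ->
     dset Omega (\val x + s *: basis_vec i + t *: basis_vec j)) ->
  exists s t (y : Omega), [/\ 0 <= s <= h, 0 <= t <= h,
   \val y = \val x + s *: basis_vec i + t *: basis_vec j &
   ext0 f (\val x + h *: basis_vec i + h *: basis_vec j) -
   ext0 f (\val x + h *: basis_vec i) -
   (ext0 f (\val x + h *: basis_vec j) - ext0 f (\val x)) =
   h * h * rpartial j (rpartial i f) y].
Proof.
move=> fC h0 hO; set u := basis_vec i; set v := basis_vec j.
have [fc fd] := fC.
have [fi fiC] := fd i; have [_ /(_ j)[fij _]] := fiC.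
pose G (z : 'rV[R]_n) : R := ext0 f (z + h *: v) - ext0 f z.
have hh : 0 <= h <= h by rewrite lexx ltW.
have h00 : (0 : R) <= 0 <= h by rewrite lexx ltW.
have dom y : dset Omega y -> exists x : Omega, y = \val x.
  by move=> Oy; exists (SigSub (mem_set Oy)).
have dv1 s : 0 <= s <= h -> derivable (ext0 f) (\val x + s *: u + h *: v) u.
  by move=> sh; have [y ->] := dom _ (hO s h sh hh).
have dv0 s : 0 <= s <= h -> derivable (ext0 f) (\val x + s *: u) u.
  by move=> sh; have := hO s 0 sh h00; rewrite scale0r addr0 => /dom[y ->].
have [|s sh Es] := @line_MVT G (\val x) u h h0.
  by move=> s sh; apply: derivableB; [apply: derivable_shiftE; exact: dv1|exact: dv0].
have {}sh : 0 <= s <= h by case/andP: sh => ? ?; rewrite !ltW.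
pose H := ext0 (rpartial i f).
have HE y : dset Omega y -> 'D_u (ext0 f) y = H y.
  by move=> /dom[z ->]; rewrite /H ext0E.
have [|t th Et] := @line_MVT H (\val x + s *: u) v h h0.
  by move=> t th; have [z ->] := dom _ (hO s t sh th); exact: fij.
have {}th : 0 <= t <= h by case/andP: th => ? ?; rewrite !ltW.
have [y yE] := dom _ (hO s t sh th).
exists s, t, y; split=> //.
move: Es; rewrite /G => ->.
rewrite deriveB; [|by apply: derivable_shiftE; exact: dv1|exact: dv0].
rewrite derive_shiftE !HE; [|by have := hO s 0 sh h00; rewrite scale0r addr0|exact: hO].
by rewrite Et mulrA yE.
Qed.

Lemma rpartialC f (i j : 'I_n) : Ck 2 f ->
  rpartial i (rpartial j f) = rpartial j (rpartial i f).
Proof.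
move=> fC; apply/funext => x.
set a := rpartial i (rpartial j f); set b := rpartial j (rpartial i f).
have [_ fd] := fC.
have ac : continuous a by have [_ [_ /(_ i)[]]] := fd j.
have bc : continuous b by have [_ [_ /(_ j)[]]] := fd i.
apply/eqP; rewrite -subr_eq0 -normr_le0; apply/ler_addgt0Pl => e e0.
rewrite addr0.
have [da da0 aP] := continuous_ball x ac (divr_gt0 e0 (ltr0n _ 2)).
have [db db0 bP] := continuous_ball x bc (divr_gt0 e0 (ltr0n _ 2)).
have /nbhs_ballP[dO /= dO0 OP] := near_domain x.
pose d := Num.min dO (Num.min da db).
have d0 : 0 < d by rewrite !lt_min dO0 da0 db0.
pose h := d / 3.
have h0 : 0 < h by rewrite divr_gt0.
have hball k l s t : 0 <= s <= h -> 0 <= t <= h ->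
    ball (\val x) d (\val x + s *: basis_vec k + t *: basis_vec l).
  move=> /andP[s0 sh] /andP[t0 th].
  rewrite -ball_normE /= -addrA opprD addNKr normrN.
  have nb m : `|basis_vec m : 'rV[R]_n| <= 1.
    rewrite [leLHS]mx_normrE; apply/bigmax_leP => //=; split=> // -[p q] _ /=.
    by rewrite mxE; case: (_ && _); rewrite /= ?normr1 ?normr0.
  rewrite (le_lt_trans (ler_normD _ _))// !normrZ !ger0_norm//.
  have A : s * `|basis_vec k : 'rV[R]_n| <= h.
    by rewrite (le_trans _ sh)// ler_piMr.
  have B : t * `|basis_vec l : 'rV[R]_n| <= h.
    by rewrite (le_trans _ th)// ler_piMr.
  rewrite (le_lt_trans (lerD A B))// /h; lra.
have hO k l s t : 0 <= s <= h -> 0 <= t <= h ->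
    dset Omega (\val x + s *: basis_vec k + t *: basis_vec l).
  move=> sh th; apply: OP; apply: le_ball (hball k l s t sh th).
  by rewrite ge_min lexx.
have [s [t [y [sh th yE Ey]]]] := second_difference fC h0 (hO i j).
have [s' [t' [z [sh' th' zE Ez]]]] := second_difference fC h0 (hO j i).
have yz : b y = a z.
  have hh : h * h != 0 by rewrite mulf_neq0 ?gt_eqF.
  apply: (mulfI hh); apply: etrans (esym Ey) _; apply: etrans _ Ez.
  rewrite [\val x + h *: basis_vec i + h *: _]addrAC.
  have aux (p q r t0 : R) : p - q - (r - t0) = p - r - (q - t0) by ring.
  exact: aux.
have By : ball (\val x) db (\val y).
  by rewrite yE; apply: le_ball (hball _ _ _ _ sh th); rewrite !ge_min lexx !orbT.
have Bz : ball (\val x) da (\val z).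
  by rewrite zE; apply: le_ball (hball _ _ _ _ sh' th'); rewrite !ge_min lexx !orbT.
have := aP _ Bz; have := bP _ By; rewrite yz.
move: (a x) (b x) (a z) => p q r H1 H2.
have -> : p - q = (p - r) - (q - r) by ring.
apply: le_trans (ler_normB _ _) _.
by rewrite (splitr e); apply: lerD; exact: ltW.
Qed.

End Schwarz.

Section ComplexFunctions.
Context {R : realType} {n : nat} {Omega : open_domain R n}.
Implicit Types (f g : Omega -> R[i]) (i j : 'I_n) (s t : seq 'I_n).

(* Complex-valued functions are handled through their real and imaginary
   parts. *)
Definition smooth f : Prop :=
  forall k, Ck k (fun x => complex.Re (f x)) /\ Ck k (fun x => complex.Im (f x)).

Definition partial j f : Omega -> R[i] := fun x =>
  rpartial j (fun y => complex.Re (f y)) x +i* rpartial j (fun y => complex.Im (f y)) x.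

Definition multi_partial (alpha : 'I_n -> nat) f : Omega -> R[i] :=
  foldr (fun j g => iter (alpha j) (partial j) g) f (enum 'I_n).

(* The supremum is taken in the extended reals: it is -oo for empty K, so that
   a bound by a real number is then vacuously true. *)
Definition supnorm (K : set Omega) f : \bar R :=
  ereal_sup [set (Normc.normc (f x))%:E | x in K].

Lemma ReDf f g : (fun x => complex.Re ((f + g) x)) =
  (fun x => complex.Re (f x)) + (fun x => complex.Re (g x)).
Proof. by apply/funext => x; rewrite !fctE; case: (f x) (g x) => ? ? []. Qed.

Lemma ImDf f g : (fun x => complex.Im ((f + g) x)) =
  (fun x => complex.Im (f x)) + (fun x => complex.Im (g x)).
Proof. by apply/funext => x; rewrite !fctE; case: (f x) (g x) => ? ? []. Qed.

Lemma ReMf f g : (fun x => complex.Re ((f * g) x)) =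
  (fun x => complex.Re (f x)) * (fun x => complex.Re (g x)) -
  (fun x => complex.Im (f x)) * (fun x => complex.Im (g x)).
Proof. by apply/funext => x; rewrite !fctE; case: (f x) (g x) => ? ? []. Qed.

Lemma ImMf f g : (fun x => complex.Im ((f * g) x)) =
  (fun x => complex.Re (f x)) * (fun x => complex.Im (g x)) +
  (fun x => complex.Im (f x)) * (fun x => complex.Re (g x)).
Proof. by apply/funext => x; rewrite !fctE; case: (f x) (g x) => ? ? []. Qed.

Lemma scale_cst (a : R[i]) f : a *: f = cst a * f.
Proof. by []. Qed.

Lemma smooth_add f g : smooth f -> smooth g -> smooth (f + g).
Proof.
move=> fs gs k; have [rf mf] := fs k; have [rg mg] := gs k.
by rewrite ReDf ImDf; split; exact: Ck_add.
Qed.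

Lemma smooth_mul f g : smooth f -> smooth g -> smooth (f * g).
Proof.
move=> fs gs k; have [rf mf] := fs k; have [rg mg] := gs k.
rewrite ReMf ImMf; split; apply: Ck_add; do ?apply: Ck_opp; exact: Ck_mul.
Qed.

Lemma smooth_cst (a : R[i]) : smooth (cst a).
Proof. by move=> k; split; exact: Ck_cst. Qed.

Lemma smooth_scale a f : smooth f -> smooth (a *: f).
Proof. by move=> fs; apply: smooth_mul => //; exact: smooth_cst. Qed.

Lemma smooth_partial j f : smooth f -> smooth (partial j f).
Proof.
move=> fs k; have [[_ /(_ j)[_ rf]] [_ /(_ j)[_ mf]]] := fs k.+1.
by split.
Qed.

Lemma partial_add j f g : smooth f -> smooth g ->
  partial j (f + g) = partial j f + partial j g.
Proof.
move=> fs gs; have [rf mf] := fs 1%N; have [rg mg] := gs 1%N.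
by apply/funext => x; rewrite /partial ReDf ImDf !rpartial_add.
Qed.

Lemma partial_mul j f g : smooth f -> smooth g ->
  partial j (f * g) = partial j f * g + f * partial j g.
Proof.
move=> fs gs; have [rf mf] := fs 1%N; have [rg mg] := gs 1%N.
apply/funext => x; rewrite /partial ReMf ImMf.
rewrite !rpartial_add; do ?[exact: Ck_mul|apply: Ck_opp].
rewrite rpartial_opp; last exact: Ck_mul.
rewrite !rpartial_mul// !fctE.
move: (rpartial _ _ x) (rpartial _ _ x) (rpartial _ _ x) (rpartial _ _ x) => a b c d.
by case: (f x) (g x) => p q [r s]; apply/eqP; rewrite eq_complex /=; apply/andP;
  split; apply/eqP; ring.
Qed.

Lemma partial_cst j (a : R[i]) : partial j (cst a) = cst 0.
Proof. by apply/funext => x; rewrite /partial !rpartial_cst. Qed.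

Lemma partial_scale j a f : smooth f -> partial j (a *: f) = a *: partial j f.
Proof.
move=> fs; rewrite scale_cst partial_mul//; last exact: smooth_cst.
by rewrite partial_cst; apply/funext => x; rewrite !fctE mul0r add0r.
Qed.

Lemma partialC i j f : smooth f -> partial i (partial j f) = partial j (partial i f).
Proof.
move=> fs; have [rf mf] := fs 2%N; apply/funext => x.
have E1 := congr1 (@^~ x) (rpartialC i j rf).
have E2 := congr1 (@^~ x) (rpartialC i j mf).
exact: (congr2 (@Complex R) E1 E2).
Qed.

Definition seq_partial s f := foldr partial f s.

Lemma smooth_seq_partial s f : smooth f -> smooth (seq_partial s f).
Proof. by move=> fs; elim: s => //= j s; exact: smooth_partial. Qed.

Lemma seq_partial_rcons s j f :
  seq_partial (rcons s j) f = seq_partial s (partial j f).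
Proof. by rewrite /seq_partial foldr_rcons. Qed.

Lemma seq_partial_add s f g : smooth f -> smooth g ->
  seq_partial s (f + g) = seq_partial s f + seq_partial s g.
Proof.
move=> fs gs; elim: s => //= j s ->.
by rewrite partial_add//; exact: smooth_seq_partial.
Qed.

Lemma seq_partial_perm s t f : smooth f -> perm_eq s t ->
  seq_partial s f = seq_partial t f.
Proof.
move=> fs; elim: s t => [|j s IH] t; first by rewrite perm_sym => /perm_nilP ->.
move=> st; have jt : j \in t by rewrite -(perm_mem st) mem_head.
case/splitPr: jt st => t1 t2.
rewrite perm_sym -[j :: t2]cat1s perm_catCA /= perm_cons perm_sym => /IH /= ->.
elim: t1 => //= i t1 <-; rewrite partialC//.
exact: smooth_seq_partial.
Qed.

Definition mseq (alpha : 'I_n -> nat) : seq 'I_n :=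
  flatten [seq nseq (alpha j) j | j <- enum 'I_n].

Lemma multi_partialE alpha f : multi_partial alpha f = seq_partial (mseq alpha) f.
Proof.
rewrite /multi_partial /mseq; elim: (enum 'I_n) => //= j s ->.
by rewrite /seq_partial foldr_cat; elim: (alpha j) => //= m ->.
Qed.

Lemma count_mseq alpha j : count_mem j (mseq alpha) = alpha j.
Proof.
rewrite /mseq count_flatten -map_comp sumnE big_map big_enum/=.
rewrite (bigD1 j)//= count_nseq /= eqxx mul1n big1 ?addn0// => i /negbTE ij.
by rewrite count_nseq /= ij.
Qed.

Lemma perm_mseq s : perm_eq s (mseq (fun j => count_mem j s)).
Proof. by apply/allP => j _ /=; rewrite count_mseq. Qed.

Lemma seq_partialE s f : smooth f ->
  seq_partial s f = multi_partial (fun j => count_mem j s) f.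
Proof.
by move=> fs; rewrite multi_partialE; apply: seq_partial_perm => //; exact: perm_mseq.
Qed.

Lemma supnorm_le K f (c : R) :
  (supnorm K f <= c%:E)%E <-> forall x, K x -> Normc.normc (f x) <= c.
Proof.
split=> [/ereal_supP fc x Kx|fc]; first by rewrite -lee_fin fc//; exists x.
by apply/ereal_supP => _ [x Kx <-]; rewrite lee_fin fc.
Qed.

End ComplexFunctions.

(* The index set ]0, 1] of the families, used below as a type. *)
Definition eps_range (R : realType) : set R := `]0%R, 1%R]%classic.

Arguments eps_range : clear implicits.

Section Families.
Context {R : realType} {n : nat} {Omega : open_domain R n}.
Local Notation family := (eps_range R -> Omega -> R[i]).
Implicit Types (f g : family) (K : set Omega) (e : eps_range R) (j : 'I_n).

(* A compact K : set Omega for the induced topology is the same thing as a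
   compact subset of the ambient space contained in Omega. *)
Definition moderate f : Prop :=
  (forall e, smooth (f e)) /\
  forall K, compact K -> forall alpha : 'I_n -> nat,
  exists (m : nat) (C eta : R), [/\ 0 < C, 0 < eta <= 1 &
    forall e, \val e <= eta ->
      (supnorm K (multi_partial alpha (f e)) <= (C * (\val e) ^- m)%:E)%E].

Definition negligible f : Prop :=
  moderate f /\
  forall K, compact K -> forall (alpha : 'I_n -> nat) (m : nat),
  exists C eta : R, [/\ 0 < C, 0 < eta <= 1 &
    forall e, \val e <= eta ->
      (supnorm K (multi_partial alpha (f e)) <= (C * (\val e) ^+ m)%:E)%E].

Definition fpartial j f : family := fun e => partial j (f e).

Definition bounded_by K (phi : R -> R) f :=
  exists C eta : R, [/\ 0 < C, 0 < eta <= 1 &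
    forall e, \val e <= eta -> forall x, K x -> Normc.normc (f e x) <= C * phi (\val e)].

Lemma eps_gt0 e : 0 < \val e.
Proof. by have := set_valP e; rewrite /eps_range /= in_itv/= => /andP[]. Qed.

Lemma eps_le1 e : \val e <= 1.
Proof. by have := set_valP e; rewrite /eps_range /= in_itv/= => /andP[]. Qed.

Lemma bounded_add K phi f g :
  bounded_by K phi f -> bounded_by K phi g -> bounded_by K phi (f + g).
Proof.
move=> [C1 [t1 [C10 /andP[t10 t11] P1]]] [C2 [t2 [C20 /andP[t20 t21] P2]]].
exists (C1 + C2), (Num.min t1 t2); split=> [||e]; first exact: addr_gt0.
  by rewrite lt_min t10 t20 ge_min t11.
rewrite le_min => /andP[e1 e2] x Kx.
rewrite (le_trans (le_normcD _ _))// mulrDl lerD ?P1 ?P2//.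
Qed.

Lemma bounded_mul K phi psi f g :
  bounded_by K phi f -> bounded_by K psi g ->
  bounded_by K (fun r => phi r * psi r) (f * g).
Proof.
move=> [C1 [t1 [C10 /andP[t10 t11] P1]]] [C2 [t2 [C20 /andP[t20 t21] P2]]].
exists (C1 * C2), (Num.min t1 t2); split=> [||e]; first exact: mulr_gt0.
  by rewrite lt_min t10 t20 ge_min t11.
rewrite le_min => /andP[e1 e2] x Kx.
have -> : (f * g) e x = f e x * g e x by [].
rewrite Normc.normcM mulrACA ler_pM ?P1 ?P2//.
  by case: (f e x) => ? ?; exact: sqrtr_ge0.
by case: (g e x) => ? ?; exact: sqrtr_ge0.
Qed.

Lemma bounded_weaken K phi psi f :
  (forall e, phi (\val e) <= psi (\val e)) ->
  bounded_by K phi f -> bounded_by K psi f.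
Proof.
move=> le [C [t [C0 t0 P]]]; exists C, t; split=> // e et x Kx.
by rewrite (le_trans (P e et x Kx))// ler_wpM2l// ltW.
Qed.

Lemma bounded_cst K (a : R[i]) : bounded_by K (fun=> 1) (cst (cst a)).
Proof.
exists (Normc.normc a + 1), 1; rewrite ltr01 lexx; split=> // [|e _ x _].
  by rewrite ltr_wpDl//; case: (a) => ? ?; exact: sqrtr_ge0.
by rewrite mulr1 lerDl.
Qed.

Definition mod_bound K f := exists m : nat, bounded_by K (fun r => r ^- m) f.
Definition neg_bound K f := forall m : nat, bounded_by K (fun r => r ^+ m) f.

Lemma mod_bound_add K f g : mod_bound K f -> mod_bound K g -> mod_bound K (f + g).
Proof.
move=> [m1 P1] [m2 P2]; exists (m1 + m2)%N.
apply: bounded_add; [apply: bounded_weaken P1|apply: bounded_weaken P2] => e.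
  rewrite lef_pV2 ?posrE ?exprn_gt0 ?eps_gt0//.
  by rewrite ler_wiXn2l ?leq_addr ?eps_le1 ?ltW ?eps_gt0.
rewrite lef_pV2 ?posrE ?exprn_gt0 ?eps_gt0//.
by rewrite ler_wiXn2l ?leq_addl ?eps_le1 ?ltW ?eps_gt0.
Qed.

Lemma mod_bound_mul K f g : mod_bound K f -> mod_bound K g -> mod_bound K (f * g).
Proof.
move=> [m1 P1] [m2 P2]; exists (m1 + m2)%N.
by apply: bounded_weaken (bounded_mul P1 P2) => e; rewrite exprD invfM.
Qed.

Lemma neg_bound_add K f g : neg_bound K f -> neg_bound K g -> neg_bound K (f + g).
Proof. by move=> P1 P2 m; exact: bounded_add. Qed.

Lemma neg_bound_mul K f g : mod_bound K f -> neg_bound K g -> neg_bound K (f * g).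
Proof.
move=> [m1 P1] P2 m.
apply: bounded_weaken (bounded_mul P1 (P2 (m1 + m)%N)) => e.
by rewrite exprD mulKf// expf_neq0// gt_eqF// eps_gt0.
Qed.

Definition fseq_partial (s : seq 'I_n) f : family := fun e => seq_partial s (f e).

Lemma moderateP f : moderate f <-> (forall e, smooth (f e)) /\
  forall K, compact K -> forall s, mod_bound K (fseq_partial s f).
Proof.
split=> -[fs P]; split=> // K cK.
  move=> s; have [m [C [t [C0 t0 Q]]]] := P K cK (fun j => count_mem j s).
  exists m, C, t; split=> // e et; apply/supnorm_le.
  by rewrite /fseq_partial seq_partialE// Q.
move=> al; have [m [C [t [C0 t0 Q]]]] := P K cK (mseq al).
exists m, C, t; split=> // e et; apply/supnorm_le.
by rewrite multi_partialE; exact: Q.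
Qed.

Lemma negligibleP f : negligible f <-> moderate f /\
  forall K, compact K -> forall s, neg_bound K (fseq_partial s f).
Proof.
split=> -[fM P]; split=> // K cK; have [fs _] := fM.
  move=> s m; have [C [t [C0 t0 Q]]] := P K cK (fun j => count_mem j s) m.
  exists C, t; split=> // e et; apply/supnorm_le.
  by rewrite /fseq_partial seq_partialE// Q.
move=> al m; have [C [t [C0 t0 Q]]] := P K cK (mseq al) m.
exists C, t; split=> // e et; apply/supnorm_le.
by rewrite multi_partialE; exact: Q.
Qed.

Lemma leibniz_bound (P Q S : family -> Prop) :
  (forall f g, S f -> S g -> S (f + g)) ->
  (forall f g, P f -> Q g -> S (f * g)) ->
  forall s f g, (forall e, smooth (f e)) -> (forall e, smooth (g e)) ->
  (forall t, P (fseq_partial t f)) -> (forall t, Q (fseq_partial t g)) ->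
  S (fseq_partial s (f * g)).
Proof.
move=> SD SM; elim/last_ind => [|s j IH] f g fs gs fP gQ.
  by apply: SM; [exact: fP [::]|exact: gQ [::]].
have -> : fseq_partial (rcons s j) (f * g) =
    fseq_partial s (fpartial j f * g) + fseq_partial s (f * fpartial j g).
  apply/funext => e; rewrite /fseq_partial seq_partial_rcons.
  have -> : (f * g) e = f e * g e by [].
  rewrite partial_mul// seq_partial_add//; apply: smooth_mul => //.
    exact: smooth_partial.
  exact: smooth_partial.
apply: SD; apply: IH => // [e|t]; try exact: smooth_partial.
  have -> : fseq_partial t (fpartial j f) = fseq_partial (rcons t j) f.
    by apply/funext => e; rewrite /fseq_partial seq_partial_rcons.
  exact: fP.
have -> : fseq_partial t (fpartial j g) = fseq_partial (rcons t j) g.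
  by apply/funext => e; rewrite /fseq_partial seq_partial_rcons.
exact: gQ.
Qed.

Lemma fseq_partial_add s f g : (forall e, smooth (f e)) -> (forall e, smooth (g e)) ->
  fseq_partial s (f + g) = fseq_partial s f + fseq_partial s g.
Proof. by move=> fs gs; apply/funext => e; exact: seq_partial_add. Qed.

Lemma fseq_partial_fpartial s j f :
  fseq_partial s (fpartial j f) = fseq_partial (rcons s j) f.
Proof. by apply/funext => e; rewrite /fseq_partial seq_partial_rcons. Qed.

Lemma moderate_add f g : moderate f -> moderate g -> moderate (f + g).
Proof.
move=> /moderateP[fs fP] /moderateP[gs gP]; apply/moderateP; split=> [e|K cK s].
  exact: smooth_add.
by rewrite fseq_partial_add//; apply: mod_bound_add; [exact: fP|exact: gP].
Qed.

Lemma moderate_mul f g : moderate f -> moderate g -> moderate (f * g).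
Proof.
move=> /moderateP[fs fP] /moderateP[gs gP]; apply/moderateP; split=> [e|K cK s].
  exact: smooth_mul.
apply: (leibniz_bound (@mod_bound_add K) (@mod_bound_mul K)) => // t.
  exact: fP.
exact: gP.
Qed.

Lemma moderate_cst (a : R[i]) : moderate (cst (cst a)).
Proof.
apply/moderateP; split=> [e|K cK s]; first exact: smooth_cst.
have : exists b, fseq_partial s (cst (cst a)) = cst (cst b).
  elim: s => [|j s [b sE]]; first by exists a.
  exists 0; apply/funext => e; rewrite -(partial_cst j b).
  by have := congr1 (@^~ e) sE; rewrite /fseq_partial /= => ->.
move=> [b ->]; exists 0%N; apply: bounded_weaken (bounded_cst K b) => e.
by rewrite expr0 invr1.
Qed.

Lemma moderate_scale a f : moderate f -> moderate (a *: f).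
Proof. exact: moderate_mul (moderate_cst a). Qed.

Lemma moderate_fpartial j f : moderate f -> moderate (fpartial j f).
Proof.
move=> /moderateP[fs fP]; apply/moderateP; split=> [e|K cK s].
  exact: smooth_partial.
by rewrite fseq_partial_fpartial; exact: fP.
Qed.

Lemma negligible_add f g : negligible f -> negligible g -> negligible (f + g).
Proof.
move=> /negligibleP[fM fP] /negligibleP[gM gP]; apply/negligibleP.
split=> [|K cK s]; first exact: moderate_add.
have [[fs _] [gs _]] := (fM, gM).
by rewrite fseq_partial_add//; apply: neg_bound_add; [exact: fP|exact: gP].
Qed.

Lemma negligible_mul f g : moderate f -> negligible g -> negligible (f * g).
Proof.
move=> fM /negligibleP[gM gP]; apply/negligibleP.
split=> [|K cK s]; first exact: moderate_mul.
have [fs fP] := (moderateP f).1 fM; have [gs _] := gM.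
apply: (leibniz_bound (@neg_bound_add K) (@neg_bound_mul K)) => // t.
  exact: fP.
exact: gP.
Qed.

Lemma negligible_fpartial j f : negligible f -> negligible (fpartial j f).
Proof.
move=> /negligibleP[fM fP]; apply/negligibleP.
split=> [|K cK s]; first exact: moderate_fpartial.
by rewrite fseq_partial_fpartial; exact: fP.
Qed.

Lemma negligible0 : negligible 0.
Proof.
have M0 : moderate 0 by exact: moderate_cst 0.
apply/negligibleP; split=> // K cK s m.
have -> : fseq_partial s 0 = 0.
  elim: s => // j s sE; apply/funext => e; rewrite -[RHS](partial_cst j 0).
  by have := congr1 (@^~ e) sE; rewrite /fseq_partial /= => ->.
exists 1, 1; rewrite ltr01 lexx; split=> // e _ x _.
rewrite (_ : Normc.normc _ = 0); last exact: Normc.normc0.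
by rewrite mul1r exprn_ge0// ltW// eps_gt0.
Qed.

Lemma negligible1 : ~ negligible 1.
Proof.
move=> [_ P]; have [x0 Ox0] := @domain_nonempty _ _ Omega.
pose x : Omega := SigSub (mem_set Ox0).
have [C [t [C0 /andP[t0 t1] Q]]] := P [set x] (@compact_set1 _ x) (fun=> 0%N) 1%N.
pose r := Num.min t (C^-1 / 2).
have rI : eps_range R r.
  rewrite /eps_range /= in_itv/= /r lt_min t0 divr_gt0 ?invr_gt0//=.
  by rewrite ge_min t1.
pose e : eps_range R := SigSub (mem_set rI).
have /supnorm_le /(_ x erefl) : (supnorm [set x] (multi_partial (fun=> 0%N) ((1%R : family) e)) <= (C * \val e ^+ 1)%:E)%E.
  by apply: Q; rewrite /= /r ge_min lexx.
have -> : multi_partial (fun=> 0%N) ((1%R : family) e) = cst 1.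
  by rewrite /multi_partial; elim: (enum _).
rewrite (_ : Normc.normc _ = 1); last exact: Normc.normc1.
rewrite expr1 => le1.
have : C * r <= 2^-1.
  by rewrite mulrC -ler_pdivlMr// mulrC /r ge_min lexx orbT.
rewrite leNgt (lt_le_trans _ le1)//; lra.
Qed.

End Families.

Section ModerateAlgebra.
Context {R : realType} {n : nat} (Omega : open_domain R n).
Local Notation family := (eps_range R -> Omega -> R[i]).

Definition moderate_pred : {pred family} := fun f => `[< moderate f >].

Lemma moderate_subring : GRing.subring_closed moderate_pred.
Proof.
split=> [|f g /asboolP fM /asboolP gM|f g /asboolP fM /asboolP gM]; apply/asboolP.
- exact: moderate_cst 1.
- rewrite -[- g]scaleN1r; apply: moderate_add => //; exact: moderate_scale.
- exact: moderate_mul.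
Qed.

Lemma moderate_submod : GRing.submod_closed moderate_pred.
Proof.
split=> [|a f g /asboolP fM /asboolP gM]; apply/asboolP.
  exact: moderate_cst 0.
by apply: moderate_add => //; exact: moderate_scale.
Qed.

HB.instance Definition _ := GRing.isSubmodClosed.Build R[i] family moderate_pred
  moderate_submod.

(* The algebra of moderate families, as a subalgebra of the algebra of all
   families ]0, 1] -> Omega -> C with pointwise operations. *)
Record moderate_family : Type := ModerateFamily {
  mod_val : family ;
  mod_valP : mod_val \in moderate_pred }.

HB.instance Definition _ := [isSub for mod_val].
HB.instance Definition _ := [Choice of moderate_family by <:].
HB.instance Definition _ := GRing.SubChoice_isSubComPzRing.Build family moderate_pred
  moderate_family moderate_subring.
HB.instance Definition _ := [SubZmodule_isSubLmodule of moderate_family by <:].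

Lemma moderate_oner_neq0 : 1 != 0 :> moderate_family.
Proof.
apply/eqP => /(congr1 mod_val) E; apply: (@negligible1 _ _ Omega).
have -> : (1%R : family) = 0%R by exact: E.
exact: negligible0.
Qed.
HB.instance Definition _ :=
  GRing.PzSemiRing_isNonZero.Build moderate_family moderate_oner_neq0.

Lemma family_scalerAl (a : R[i]) (f g : family) : a *: (f * g) = a *: f * g.
Proof.
by apply/funext => e; apply/funext => x; exact: (mulrA a (f e x) (g e x)).
Qed.

Lemma mod_valD (u v : moderate_family) : mod_val (u + v) = mod_val u + mod_val v.
Proof. reflexivity. Qed.

Lemma mod_valM (u v : moderate_family) : mod_val (u * v) = mod_val u * mod_val v.
Proof. reflexivity. Qed.

Lemma mod_valZ a (u : moderate_family) : mod_val (a *: u) = a *: mod_val u.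
Proof. reflexivity. Qed.

Lemma mod_valN (u : moderate_family) : mod_val (- u) = - mod_val u.
Proof. reflexivity. Qed.

Lemma moderate_mod_val (u : moderate_family) : moderate (mod_val u).
Proof. exact/asboolP/(mod_valP u). Qed.

Lemma moderate_scalerAl (a : R[i]) (u v : moderate_family) :
  a *: (u * v) = a *: u * v.
Proof.
apply: val_inj; exact: (family_scalerAl a (mod_val u) (mod_val v)).
Qed.
HB.instance Definition _ :=
  GRing.Lmodule_isLalgebra.Build R[i] moderate_family moderate_scalerAl.
HB.instance Definition _ :=
  GRing.Lalgebra_isComAlgebra.Build R[i] moderate_family.

Lemma mod_partial_subproof (j : 'I_n) (u : moderate_family) :
  fpartial j (mod_val u) \in moderate_pred.
Proof. by apply/asboolP/moderate_fpartial/asboolP/mod_valP. Qed.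
Definition mod_partial (j : 'I_n) (u : moderate_family) : moderate_family :=
  ModerateFamily (mod_partial_subproof j u).

Definition negligible_pred : {pred moderate_family} :=
  fun u => `[< negligible (mod_val u) >].

Lemma negligible_ideal : idealr_closed negligible_pred.
Proof.
split; first by apply/asboolP; exact: negligible0.
  by apply/negP => /asboolP; exact: negligible1.
move=> a u v /asboolP uN /asboolP vN; apply/asboolP.
rewrite mod_valD mod_valM; apply: (negligible_add _ vN).
exact: (negligible_mul (moderate_mod_val a) uN).
Qed.
HB.instance Definition _ := isIdealr.Build moderate_family negligible_pred
  negligible_ideal.

Definition colombeau : Type := {ideal_quot negligible_pred}.
HB.instance Definition _ := GRing.ComNzRing.on colombeau.
HB.instance Definition _ := Quotient.on colombeau.

Local Open Scope quotient_scope.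
Definition colombeau_class (u : moderate_family) : colombeau :=
  \pi_({ideal_quot negligible_pred}) u.

Lemma colombeau_class_eq (u v : moderate_family) :
  colombeau_class u = colombeau_class v <-> negligible (mod_val u - mod_val v).
Proof.
have E := Quotient.idealrBE negligible_pred u v.
split=> [/eqP H|H]; last by apply/eqP; rewrite -[_ == _]E; apply/asboolP.
by apply/asboolP; rewrite -[`[< _ >]]/(u - v \in negligible_pred) E.
Qed.

Lemma colombeau_class_repr (a : colombeau) : colombeau_class (repr a) = a.
Proof. exact: reprK. Qed.

Lemma colombeau_classD u v :
  colombeau_class (u + v) = colombeau_class u + colombeau_class v.
Proof. exact: Quotient.pi_add. Qed.

Lemma colombeau_classM u v :
  colombeau_class (u * v) = colombeau_class u * colombeau_class v.
Proof. exact: Quotient.pi_mul. Qed.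

Lemma colombeau_class1 : colombeau_class 1 = 1.
Proof. by rewrite /GRing.one /=; unlock Quotient.one. Qed.

Definition colombeau_scale (c : R[i]) (a : colombeau) : colombeau :=
  colombeau_class (c *: repr a).

Lemma negligible_scale (c : R[i]) (f : family) : negligible f -> negligible (c *: f).
Proof. exact: (negligible_mul (moderate_cst c)). Qed.

Lemma colombeau_class_scale c u :
  colombeau_class (c *: u) = colombeau_scale c (colombeau_class u).
Proof.
apply/colombeau_class_eq; rewrite !mod_valZ -scalerBr; apply: negligible_scale.
by apply/colombeau_class_eq; rewrite colombeau_class_repr.
Qed.

Lemma colombeau_scaleA c d a :
  colombeau_scale c (colombeau_scale d a) = colombeau_scale (c * d) a.
Proof. by rewrite -(colombeau_class_repr a) -!colombeau_class_scale scalerA. Qed.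

Lemma colombeau_scale1 : left_id 1 colombeau_scale.
Proof.
by move=> a; rewrite -(colombeau_class_repr a) -colombeau_class_scale scale1r.
Qed.

Lemma colombeau_scaleDr : right_distributive colombeau_scale +%R.
Proof.
move=> c a b; rewrite -(colombeau_class_repr a) -(colombeau_class_repr b).
by rewrite -colombeau_classD -!colombeau_class_scale -colombeau_classD scalerDr.
Qed.

Lemma colombeau_scaleDl a : {morph colombeau_scale^~ a : c d / c + d}.
Proof.
move=> c d; rewrite -(colombeau_class_repr a) -!colombeau_class_scale.
by rewrite -colombeau_classD scalerDl.
Qed.

HB.instance Definition _ := GRing.Zmodule_isLmodule.Build R[i] colombeau
  colombeau_scaleA colombeau_scale1 colombeau_scaleDr colombeau_scaleDl.

Lemma colombeau_classZ c u :
  colombeau_class (c *: u) = c *: colombeau_class u.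
Proof. exact: colombeau_class_scale. Qed.

Lemma colombeau_scalerAl (c : R[i]) (a b : colombeau) : c *: (a * b) = c *: a * b.
Proof.
rewrite -(colombeau_class_repr a) -(colombeau_class_repr b) -colombeau_classM.
by rewrite -!colombeau_classZ -colombeau_classM scalerAl.
Qed.
HB.instance Definition _ :=
  GRing.Lmodule_isLalgebra.Build R[i] colombeau colombeau_scalerAl.
HB.instance Definition _ := GRing.Lalgebra_isComAlgebra.Build R[i] colombeau.

(* The choice of the representative [repr a] is immaterial, see
   [colombeau_class_partial]; the same holds for [colombeau_scale]. *)
Definition colombeau_partial (j : 'I_n) (a : colombeau) : colombeau :=
  colombeau_class (mod_partial j (repr a)).

Lemma mod_partial_linear j (c : R[i]) u v :
  mod_partial j (c *: u + v) = c *: mod_partial j u + mod_partial j v.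
Proof.
apply: val_inj; apply/funext => e.
have us e' : smooth (mod_val u e') by have [] := moderate_mod_val u.
have vs e' : smooth (mod_val v e') by have [] := moderate_mod_val v.
transitivity (partial j (c *: mod_val u e + mod_val v e)); first by [].
by rewrite partial_add ?partial_scale//; exact: smooth_scale.
Qed.

Lemma mod_partialB j u v :
  mod_partial j (u - v) = mod_partial j u - mod_partial j v.
Proof.
by rewrite [u - v]addrC -scaleN1r mod_partial_linear scaleN1r addrC.
Qed.

Lemma mod_partial_leibniz j u v :
  mod_partial j (u * v) = mod_partial j u * v + u * mod_partial j v.
Proof.
apply: val_inj; apply/funext => e.
have us e' : smooth (mod_val u e') by have [] := moderate_mod_val u.
have vs e' : smooth (mod_val v e') by have [] := moderate_mod_val v.
exact: (partial_mul j (us e) (vs e)).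
Qed.

Lemma mod_partialC i j u :
  mod_partial i (mod_partial j u) = mod_partial j (mod_partial i u).
Proof.
apply: val_inj; apply/funext => e; apply: partialC.
by have [] := moderate_mod_val u.
Qed.

Lemma colombeau_class_partial j u :
  colombeau_class (mod_partial j u) = colombeau_partial j (colombeau_class u).
Proof.
apply/colombeau_class_eq; set v := repr _.
rewrite -mod_valN -mod_valD -mod_partialB.
apply: (@negligible_fpartial _ _ _ j (mod_val (u - v))); apply/colombeau_class_eq.
by rewrite colombeau_class_repr.
Qed.

Lemma colombeau_partial_linear j (c : R[i]) a b :
  colombeau_partial j (c *: a + b) =
  c *: colombeau_partial j a + colombeau_partial j b.
Proof.
rewrite -(colombeau_class_repr a) -(colombeau_class_repr b).
rewrite -colombeau_classZ -colombeau_classD.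
rewrite -!colombeau_class_partial mod_partial_linear colombeau_classD.
by rewrite colombeau_classZ.
Qed.

Lemma colombeau_partial_leibniz j a b :
  colombeau_partial j (a * b) =
  colombeau_partial j a * b + a * colombeau_partial j b.
Proof.
rewrite -(colombeau_class_repr a) -(colombeau_class_repr b) -colombeau_classM.
rewrite -!colombeau_class_partial mod_partial_leibniz colombeau_classD.
by rewrite !colombeau_classM.
Qed.

Lemma colombeau_partialC i j a :
  colombeau_partial i (colombeau_partial j a) =
  colombeau_partial j (colombeau_partial i a).
Proof.
by rewrite -(colombeau_class_repr a) -!colombeau_class_partial mod_partialC.
Qed.

End ModerateAlgebra.

(* A unital subalgebra that is stable under the operators d i. *)
Definition differential_subalgebra (K : pzRingType) (A : lalgType K) (I : Type)
    (d : I -> A -> A) (S : set A) : Prop :=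
  GRing.subalg_closed (fun u : A => u \in S) /\
  forall (i : I) (u : A), S u -> S (d i u).

Record regular_set (R : realType) (Rg : set (nat -> R)) : Prop := {
  regular_nonempty : Rg !=set0 ;
  regular_ge0 : forall N, Rg N -> forall m, 0 <= N m ;
  regular_shift : forall N, Rg N -> forall k k' : nat,
    exists2 N', Rg N' & forall m, N (m + k)%N + k'%:R <= N' m ;
  regular_max : forall N N', Rg N -> Rg N' ->
    exists2 N'', Rg N'' & forall m, Num.max (N m) (N' m) <= N'' m ;
  regular_add : forall N N', Rg N -> Rg N' ->
    exists2 N'', Rg N'' & forall l1 l2, N l1 + N' l2 <= N'' (l1 + l2)%N }.

Record weight_sequence (R : realType) (M : nat -> R) : Prop := {
  weight_gt0 : forall p, 0 < M p ;
  weight0 : M 0%N = 1 ;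
  weight_log_convex : forall p, (1 <= p)%N -> M p ^+ 2 <= M p.-1 * M p.+1 ;
  weight_stable : exists A H : R, [/\ 0 < A, 0 < H &
    forall p q, (q <= p)%N -> M p <= A * H ^+ p * M q * M (p - q)%N] ;
  weight_nonquasianalytic :
    (\sum_(1 <= p <oo) (M p.-1 / M p)%:E < +oo)%E }.

Section Ultraregular.
Context {R : realType} {n : nat} (Omega : open_domain R n).
Variables (M : nat -> R) (Rg : set (nat -> R)).
Local Notation family := (eps_range R -> Omega -> R[i]).

Definition ultraregular (f : family) : Prop :=
  (forall e, smooth (f e)) /\
  forall K : set Omega, compact K ->
  exists (N : nat -> R) (C e0 : R), [/\ Rg N, 0 < C, 0 < e0 <= 1 &
    forall (alpha : 'I_n -> nat) (e : eps_range R), \val e <= e0 ->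
      let a := (\sum_j alpha j)%N in
      (supnorm K (multi_partial alpha (f e)) <=
        (C ^+ a.+1 * M a * (\val e) `^ (- N a))%:E)%E].

Definition ultranegligible (f : family) : Prop := negligible f /\ ultraregular f.

(* The quotient X^{M,R} / N^{M,R} is represented by the set of its cosets; this
   presupposes no closure property of X^{M,R}. *)
Definition ultra_coset (f : family) : set family :=
  [set g | ultraregular g /\ ultranegligible (g - f)].

Definition ultra_colombeau : Type :=
  {c : set family | exists2 f, ultraregular f & c = ultra_coset f}.

Definition ultra_class (f : family) (fU : ultraregular f) : ultra_colombeau :=
  exist _ (ultra_coset f) (ex_intro2 _ _ f fU erefl).

End Ultraregular.

(* Main.v *)
Require Import Defs.
From mathcomp Require Import all_boot all_order all_algebra.
From mathcomp Require Import all_classical all_reals all_analysis.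
From mathcomp Require Import complex.
From mathcomp Require Import ring.
Import Order.TTheory GRing.Theory Num.Theory.
Import numFieldNormedType.Exports.
Local Open Scope classical_set_scope.
Local Open Scope ring_scope.

(** A family is ultraregular when its derivatives of order [k] are bounded on
    each compact set by [C ^ (k + 1) * M k * e ^ (- N k)], uniformly in [k].
    Each operation preserves bounds of this shape, because what it costs is
    absorbed by the growth conditions on [M] and on the regular set:

    - a product: in the Leibniz formula for order [k] there are [2 ^ k] terms,
      each a product of derivatives of orders [i] and [k - i].  Log-convexity
      together with [M 0 = 1] gives [M i * M (k - i) <= M k]
      ([weight_supermultiplicative]), condition (R3) bounds
      [N1 i + N2 (k - i)] by [N k], and [2 ^ k] goes into the geometric
      constant ([ultraregular_mul]);
    - a derivative: stability of [M] under differentiation bounds [M (k + 1)]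
      by a geometric factor times [M k], and (R1) absorbs the shift in [N]
      ([ultraregular_fpartial]);
    - a sum: (R2) provides a common exponent ([ultraregular_add]).

    For a fixed order the bound is a power of [1 / e], so ultraregular families
    are moderate.  Hence they form a differential subalgebra of the moderate
    families, and its image under the quotient map is a differential
    subalgebra of the Colombeau algebra.  Finally two ultraregular families
    have the same Colombeau class exactly when their difference, which is
    again ultraregular, is negligible, that is, when they define the same coset
    of the ultranegligible families; this makes the induced map injective. *)

(** * Weight sequences and exponents *)

Section WeightSequence.
Context {R : realType} {M : nat -> R}.
Hypothesis hM : weight_sequence M.

(** The quotients [M p.+1 / M p] are nondecreasing: this is log-convexity,
    iterated and cleared of denominators. *)
Lemma weight_ratio_le p q : (p <= q)%N -> M p.+1 * M q <= M p * M q.+1.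
Proof.
move=> /subnKC <-; elim: (q - p)%N => [|d IH].
  by rewrite addn0 mulrC.
rewrite addnS; set r := (p + d)%N in IH *.
rewrite -(ler_pM2r (weight_gt0 hM r)).
have /= cvx := weight_log_convex hM (isT : (1 <= r.+1)%N).
have -> : M p.+1 * M r.+1 * M r = M p.+1 * M r * M r.+1 by ring.
have -> : M p * M r.+2 * M r = M p * (M r * M r.+2) by ring.
apply: le_trans (ler_wpM2l (ltW (weight_gt0 hM p)) cvx).
by rewrite expr2 mulrA ler_wpM2r// ltW// (weight_gt0 hM).
Qed.

Lemma weight_supermultiplicative p q : M p * M q <= M (p + q)%N.
Proof.
elim: p => [|p IH]; first by rewrite (weight0 hM) mul1r.
rewrite addSn -(ler_pM2l (weight_gt0 hM p)).
apply: le_trans (weight_ratio_le _ _ (leq_addr q p)).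
by rewrite mulrCA ler_wpM2l// ltW// (weight_gt0 hM).
Qed.

Lemma weight_succ_le : exists A H : R, [/\ 0 < A, 0 < H &
  forall k, M k.+1 <= A * H ^+ k.+1 * M k].
Proof.
have [A [H [A0 H0 stab]]] := weight_stable hM.
exists (A * M 1), H; split=> // [|k]; first by rewrite mulr_gt0 ?(weight_gt0 hM).
have := stab k.+1 1%N (isT : (1 <= k.+1)%N); rewrite subSS subn0.
by rewrite -mulrA mulrAC -!mulrA [M k * _]mulrC.
Qed.

End WeightSequence.

Lemma eps_powR_le {R : realType} (e : eps_range R) (a b : R) :
  a <= b -> (\val e) `^ (- a) <= (\val e) `^ (- b).
Proof.
move=> ab; apply: ger_powR; last by rewrite lerN2.
by rewrite eps_gt0 eps_le1.
Qed.

Lemma normc_ge0 {R : realType} (z : R[i]) : 0 <= Normc.normc z.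
Proof. by case: z => a b; exact: sqrtr_ge0. Qed.

(** * The Leibniz estimate *)

Section Leibniz.
Context {R : realType} {n : nat} {Omega : open_domain R n}.
Implicit Types (f g : Omega -> R[i]) (s t : seq 'I_n).

(** Each of the [size s] derivations doubles the number of terms and sends one
    more derivative to exactly one of the two factors. *)
Lemma leibniz_le s f g x (B : R) : smooth f -> smooth g ->
  (forall t1 t2, (size t1 + size t2 = size s)%N ->
     Normc.normc (seq_partial t1 f x) * Normc.normc (seq_partial t2 g x) <= B) ->
  Normc.normc (seq_partial s (f * g) x) <= 2 ^+ size s * B.
Proof.
elim/last_ind: s f g => [|s j IH] f g fs gs fgB.
  by rewrite /= expr0 mul1r Normc.normcM; exact: (fgB [::] [::]).
have fjs := smooth_partial j fs; have gjs := smooth_partial j gs.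
rewrite seq_partial_rcons partial_mul// seq_partial_add; [|exact: smooth_mul..].
apply: le_trans (le_normcD _ _) _.
rewrite size_rcons exprS -mulrA mulr_natl mulr2n.
apply: lerD; apply: IH => // t1 t2 st; rewrite -seq_partial_rcons.
  by apply: fgB; rewrite !size_rcons addSn st.
by apply: fgB; rewrite !size_rcons addnS st.
Qed.

End Leibniz.

(** * Ultraregular families *)

Section UltraregularFamilies.
Context {R : realType} {n : nat} {Omega : open_domain R n}.
Context {M : nat -> R} {Rg : set (nat -> R)}.
Hypotheses (hRg : regular_set Rg) (hM : weight_sequence M).
Local Notation family := (eps_range R -> Omega -> R[i]).
Local Notation ultraregular := (@ultraregular R n Omega M Rg).
Implicit Types (f g : family) (K : set Omega).

(** Derivatives are indexed by the list of successive directions, which suits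
    induction better than multi-indices; for smooth functions only the
    multi-index of the list matters, see [ultraregularP]. *)
Definition ultra_bound K f := exists (N : nat -> R) (C e0 : R),
  [/\ Rg N, 0 < C, 0 < e0 <= 1 &
    forall (s : seq 'I_n) (e : eps_range R), \val e <= e0 -> forall x, K x ->
      Normc.normc (seq_partial s (f e) x) <=
        C ^+ (size s).+1 * M (size s) * (\val e) `^ (- N (size s))].

Lemma sum_count_mem (s : seq 'I_n) : (\sum_j count_mem j s = size s)%N.
Proof.
elim: s => [|i s IH] /=; first by rewrite big1.
by rewrite big_split /= IH (bigD1 i)//= eqxx big1// => j /negbTE; rewrite eq_sym => ->.
Qed.

Lemma size_mseq (alpha : 'I_n -> nat) : size (mseq alpha) = (\sum_j alpha j)%N.
Proof. by rewrite -sum_count_mem; apply: eq_bigr => j _; rewrite count_mseq. Qed.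

Lemma ultraregularP f : ultraregular f <->
  (forall e, smooth (f e)) /\ forall K, compact K -> ultra_bound K f.
Proof.
split=> -[fs P]; split=> // K cK; have [N [C [e0 [NR C0 e00 Q]]]] := P K cK.
  exists N, C, e0; split=> // s e ee0; apply/supnorm_le.
  by rewrite seq_partialE// -sum_count_mem; exact: Q.
exists N, C, e0; split=> // alpha e ee0 /=; apply/supnorm_le.
by rewrite multi_partialE -size_mseq; exact: Q.
Qed.

Lemma ultra_bound_add K f g :
  (forall e, smooth (f e)) -> (forall e, smooth (g e)) ->
  ultra_bound K f -> ultra_bound K g -> ultra_bound K (f + g).
Proof.
move=> fs gs [N1 [C1 [t1 [N1R C10 /andP[t10 t11] P1]]]].
move=> [N2 [C2 [t2 [N2R C20 /andP[t20 t21] P2]]]].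
have [N NR maxN] := regular_max hRg N1R N2R.
exists N, (C1 + C2), (Num.min t1 t2); split=> // [||s e]; first exact: addr_gt0.
  by rewrite lt_min t10 t20 ge_min t11.
rewrite le_min => /andP[e1 e2] x Kx.
rewrite [(f + g) e]/(f e + g e) seq_partial_add//.
apply: le_trans (le_normcD _ _) _.
set k := size s; set E := \val e `^ (- N k).
have /andP[N1k N2k] : (N1 k <= N k) && (N2 k <= N k) by rewrite -ge_max.
have Mk := ltW (weight_gt0 hM k).
have C12 : C1 ^+ k.+1 + C2 ^+ k.+1 <= (C1 + C2) ^+ k.+1.
  have CC : 0 <= C1 + C2 by rewrite addr_ge0 ?ltW.
  rewrite [leRHS]exprS mulrDl !exprS lerD// ler_wpM2l ?(ltW C10) ?(ltW C20)//.
    by rewrite lerXn2r ?nnegrE ?(ltW C10)// lerDl ltW.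
  by rewrite lerXn2r ?nnegrE ?(ltW C20)// lerDr ltW.
apply: le_trans (lerD (P1 s e e1 x Kx) (P2 s e e2 x Kx)) _.
apply: le_trans (_ : (C1 ^+ k.+1 + C2 ^+ k.+1) * M k * E <= _); last first.
  by rewrite ler_wpM2r ?powR_ge0// ler_wpM2r.
by rewrite !mulrDl lerD// ler_wpM2l ?mulr_ge0 ?exprn_ge0 ?eps_powR_le ?(ltW C10) ?(ltW C20).
Qed.

Lemma ultra_bound_mul K f g :
  (forall e, smooth (f e)) -> (forall e, smooth (g e)) ->
  ultra_bound K f -> ultra_bound K g -> ultra_bound K (f * g).
Proof.
move=> fs gs [N1 [C1 [t1 [N1R C10 /andP[t10 t11] P1]]]].
move=> [N2 [C2 [t2 [N2R C20 /andP[t20 t21] P2]]]].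
have [N NR addN] := regular_add hRg N1R N2R.
pose D := 1 + C1 + C2.
have D1 : 1 <= D by rewrite /D -addrA lerDl addr_ge0// ltW.
have D0 : 0 < D by exact: lt_le_trans D1.
have C1D : C1 <= D by rewrite /D -addrA addrCA lerDl addr_ge0// ltW.
have C2D : C2 <= D by rewrite /D lerDr addr_ge0// ltW.
(* The factor [2 * D ^+ 2] absorbs [2 ^+ k] and the [k.+2] constants of the two
   factors, as [k.+2 <= 2 * k.+1]. *)
exists N, (2 * D ^+ 2), (Num.min t1 t2); split=> // [||s e].
- by rewrite mulr_gt0// exprn_gt0.
- by rewrite lt_min t10 t20 ge_min t11.
rewrite le_min => /andP[e1 e2] x Kx; set k := size s.
have E0 : 0 <= \val e `^ (- N k) by exact: powR_ge0.
have Mk := ltW (weight_gt0 hM k).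
apply: le_trans (_ : 2 ^+ k * (D ^+ k.+2 * M k * \val e `^ (- N k)) <= _).
  apply: leibniz_le => // s1 s2 s12; have {}s12 : (size s1 + size s2)%N = k by [].
  apply: le_trans (ler_pM (normc_ge0 _) (normc_ge0 _) (P1 s1 e e1 x Kx) (P2 s2 e e2 x Kx)) _.
  move: (size s1) (size s2) s12 => p q pq.
  rewrite mulrACA [_ * M p * _]mulrACA -powRD; last by rewrite (gt_eqF (eps_gt0 e)) implybT.
  have M0 r := ltW (weight_gt0 hM r).
  have Cpq : 0 <= C1 ^+ p.+1 * C2 ^+ q.+1.
    by rewrite mulr_ge0 ?exprn_ge0 ?(ltW C10) ?(ltW C20).
  have Mpq : 0 <= M p * M q by exact: mulr_ge0.
  apply: ler_pM; [exact: mulr_ge0|exact: powR_ge0| |]; last first.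
    by rewrite -opprD eps_powR_le// -pq addN.
  apply: ler_pM => //; last by rewrite -pq; exact: weight_supermultiplicative.
  have -> : k.+2 = (p.+1 + q.+1)%N by rewrite addSn addnS pq.
  rewrite exprD ler_pM ?exprn_ge0 ?(ltW C10) ?(ltW C20)//.
    by rewrite lerXn2r ?nnegrE ?(ltW C10) ?(ltW D0).
  by rewrite lerXn2r ?nnegrE ?(ltW C20) ?(ltW D0).
rewrite mulrA ler_wpM2r// mulrA ler_wpM2r// exprMn.
rewrite -exprM; apply: ler_pM; rewrite ?exprn_ge0 ?(ltW D0)//.
  by rewrite ler_weXn2l// ler1n.
by rewrite ler_weXn2l// mul2n -addnn addSn addnS !ltnS leq_addr.
Qed.

Lemma ultra_bound_fpartial K j f : ultra_bound K f -> ultra_bound K (fpartial j f).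
Proof.
move=> [N [C [e0 [NR C0 e00 P]]]].
have [N' N'R shiftN] := regular_shift hRg NR 1%N 0%N.
have [A [H [A0 H0 MS]]] := weight_succ_le hM.
have CA : 0 < C * A by exact: mulr_gt0.
(* [1 + C * A] absorbs the isolated factor [C * A], as it is at most
   [(1 + C * A) ^+ k.+1]. *)
exists N', (C * H * (1 + C * A)), e0; split=> // [|s e ee0 x Kx].
  by rewrite !mulr_gt0 ?addr_gt0.
rewrite /fpartial -seq_partial_rcons.
apply: le_trans (P _ e ee0 x Kx) _; rewrite size_rcons; set k := size s.
have Mk := ltW (weight_gt0 hM k).
have Ck2 : 0 <= C ^+ k.+2 by exact: exprn_ge0 (ltW C0).
have Mk1 := ltW (weight_gt0 hM k.+1).
apply: ler_pM; [exact: mulr_ge0|exact: powR_ge0| |]; last first.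
  by apply: eps_powR_le; have := shiftN k; rewrite addn1 addr0.
apply: le_trans (ler_wpM2l Ck2 (MS k)) _.
have -> : C ^+ k.+2 * (A * H ^+ k.+1 * M k) = (C * H) ^+ k.+1 * (C * A) * M k.
  by rewrite exprMn exprS; ring.
rewrite [leRHS]mulrC [leLHS]mulrC ler_wpM2l// [leRHS]exprMn.
rewrite ler_wpM2l ?exprn_ge0 ?mulr_ge0 ?(ltW C0) ?(ltW H0)//.
apply: le_trans (_ : 1 + C * A <= _); first by rewrite lerDr.
by rewrite ler_eXnr// lerDl ltW.
Qed.

Lemma ultraregular_add f g :
  ultraregular f -> ultraregular g -> ultraregular (f + g).
Proof.
move=> /ultraregularP[fs fP] /ultraregularP[gs gP]; apply/ultraregularP.
split=> [e|K cK]; first exact: smooth_add.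
by apply: ultra_bound_add => //; [exact: fP|exact: gP].
Qed.

Lemma ultraregular_mul f g :
  ultraregular f -> ultraregular g -> ultraregular (f * g).
Proof.
move=> /ultraregularP[fs fP] /ultraregularP[gs gP]; apply/ultraregularP.
split=> [e|K cK]; first exact: smooth_mul.
by apply: ultra_bound_mul => //; [exact: fP|exact: gP].
Qed.

Lemma ultraregular_fpartial j f : ultraregular f -> ultraregular (fpartial j f).
Proof.
move=> /ultraregularP[fs fP]; apply/ultraregularP.
split=> [e|K cK]; first exact: smooth_partial.
by apply: ultra_bound_fpartial; exact: fP.
Qed.

Lemma ultraregular_cst (a : R[i]) : ultraregular (cst (cst a)).
Proof.
apply/ultraregularP; split=> [e|K cK]; first exact: smooth_cst.
have [N NR] := regular_nonempty hRg.
have C1 : 1 <= 1 + Normc.normc a by rewrite lerDl normc_ge0.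
have C0 : 0 < 1 + Normc.normc a by exact: lt_le_trans C1.
exists N, (1 + Normc.normc a), 1; rewrite ltr01 lexx; split=> // s e _ x _.
have [->|s0] := eqVneq s [::].
  rewrite /= expr1 (weight0 hM) mulr1.
  apply: le_trans (_ : 1 + Normc.normc a <= _); first by rewrite lerDr.
  rewrite ler_peMr ?(ltW C0)// -(powRr0 (\val e)) -oppr0.
  by apply: eps_powR_le; exact: (regular_ge0 hRg NR).
have -> : seq_partial s (cst a : Omega -> R[i]) = cst 0.
  (* The argument of the outermost derivation is the constant [a] when it is
     the only one, and [0] otherwise. *)
  case: s s0 => // j s _; rewrite /= -(partial_cst j (if s is [::] then a else 0)).
  congr (partial j _); elim: s => //= i s ->.
  by rewrite partial_cst.
rewrite [Normc.normc _]Normc.normc0.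
by rewrite !mulr_ge0 ?exprn_ge0 ?powR_ge0 ?(ltW C0)// ltW// (weight_gt0 hM).
Qed.

Lemma ultraregular_scale (a : R[i]) f : ultraregular f -> ultraregular (a *: f).
Proof. exact: ultraregular_mul (ultraregular_cst a). Qed.

Lemma ultraregular_sub f g :
  ultraregular f -> ultraregular g -> ultraregular (f - g).
Proof.
move=> fU gU; rewrite -[- g]scaleN1r.
by apply: ultraregular_add => //; exact: ultraregular_scale.
Qed.

Lemma ultraregular_moderate f : ultraregular f -> moderate f.
Proof.
move=> /ultraregularP[fs fP]; apply/moderateP; split=> // K cK s.
have [N [C [e0 [NR C0 e00 P]]]] := fP K cK.
exists (Num.truncn (N (size s))).+1, (C ^+ (size s).+1 * M (size s)), e0.
split=> // [|e ee0 x Kx].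
  by rewrite mulr_gt0 ?exprn_gt0 ?(weight_gt0 hM).
apply: le_trans (P s e ee0 x Kx) _.
rewrite ler_wpM2l ?mulr_ge0 ?exprn_ge0 ?(ltW C0) ?(ltW (weight_gt0 hM _))//.
rewrite -powR_mulrn ?(ltW (eps_gt0 _))// -powRN.
apply: eps_powR_le; apply/ltW; exact: truncnS_gt.
Qed.

Lemma ultranegligible0 : ultranegligible M Rg (0 : family).
Proof. by split; [exact: negligible0|exact: (ultraregular_cst 0)]. Qed.

Lemma ultra_coset_id f : ultraregular f -> ultra_coset M Rg f f.
Proof. by move=> fU; split=> //; rewrite subrr; exact: ultranegligible0. Qed.

(** Only negligibility of [f - g] has to be checked: differences of
    ultraregular families are ultraregular. *)
Lemma ultra_coset_eq f g : ultraregular f -> ultraregular g ->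
  ultra_coset M Rg f = ultra_coset M Rg g <-> Defs.negligible (f - g).
Proof.
have sub h1 h2 : ultraregular h1 -> ultraregular h2 -> Defs.negligible (h1 - h2) ->
    ultra_coset M Rg h1 `<=` ultra_coset M Rg h2.
  move=> h1U h2U h12 h [hU [hh1 _]]; split=> //; split.
    have -> : h - h2 = (h - h1) + (h1 - h2) by rewrite addrA subrK.
    exact: negligible_add.
  exact: ultraregular_sub.
move=> fU gU; split=> [fg|fg].
  by have := ultra_coset_id _ fU; rewrite {1}fg => -[_ []].
apply/seteqP; split; apply: sub => //.
by rewrite -opprB -scaleN1r; exact: negligible_scale.
Qed.

End UltraregularFamilies.

(** * The subalgebras *)

Section UltraregularSubalgebras.
Context {R : realType} {n : nat} {Omega : open_domain R n}.
Context {M : nat -> R} {Rg : set (nat -> R)}.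
Hypotheses (hRg : regular_set Rg) (hM : weight_sequence M).

Definition ultra_moderate : set (moderate_family Omega) :=
  [set u | ultraregular M Rg (mod_val u)].

Lemma ultra_moderate_subalgebra :
  differential_subalgebra (@mod_partial R n Omega) ultra_moderate.
Proof.
split=> [|j u uU]; last exact: (ultraregular_fpartial hRg hM).
split=> [|a u v /set_mem uU /set_mem vU|u v /set_mem uU /set_mem vU];
  apply/mem_set.
- exact: (ultraregular_cst hRg hM 1).
- rewrite /ultra_moderate /mkset mod_valD mod_valZ.
  by apply: (ultraregular_add hRg hM) => //; apply: (ultraregular_scale hRg hM).
- rewrite /ultra_moderate /mkset mod_valM.
  by apply: (ultraregular_mul hRg hM).
Qed.

(** The quotient map is a morphism of differential algebras. *)
Lemma colombeau_class_subalgebra (S : set (moderate_family Omega)) :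
  differential_subalgebra (@mod_partial R n Omega) S ->
  differential_subalgebra (@colombeau_partial R n Omega)
    (@colombeau_class R n Omega @` S).
Proof.
move=> [[S1 SZD SM] SP]; split=> [|j _ [u Su <-]]; last first.
  by exists (mod_partial j u); [exact: SP|exact: colombeau_class_partial].
split=> [|a _ _ /set_mem[u Su <-] /set_mem[v Sv <-]|_ _ /set_mem[u Su <-] /set_mem[v Sv <-]];
  apply/mem_set.
- by exists 1; [exact: set_mem|exact: colombeau_class1].
- exists (a *: u + v); last by rewrite colombeau_classD colombeau_classZ.
  by apply: set_mem; apply: SZD; exact: mem_set.
- exists (u * v); last exact: colombeau_classM.
  by apply: set_mem; apply: SM; exact: mem_set.
Qed.

Definition ultra_moderate_family (f : eps_range R -> Omega -> R[i])
  (fU : ultraregular M Rg f) : moderate_family Omega :=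
  ModerateFamily (asboolT (ultraregular_moderate hM f fU) : f \in @moderate_pred R n Omega).

(** The choice of a representative of the coset is immaterial, see
    [ultra_embed_class]. *)
Definition ultra_embed (c : @ultra_colombeau R n Omega M Rg) : colombeau Omega :=
  colombeau_class (ultra_moderate_family _ (s2valP (cid2 (svalP c)))).

Lemma ultra_embedP (c : @ultra_colombeau R n Omega M Rg) :
  exists2 u, ultra_moderate u &
    proj1_sig c = ultra_coset M Rg (mod_val u) /\ ultra_embed c = colombeau_class u.
Proof.
exists (ultra_moderate_family _ (s2valP (cid2 (svalP c)))).
  exact: (s2valP (cid2 (svalP c))).
by split=> //; exact: (s2valP' (cid2 (svalP c))).
Qed.

Lemma ultra_embed_class (u : moderate_family Omega)
  (uU : ultraregular M Rg (mod_val u)) :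
  ultra_embed (ultra_class uU) = colombeau_class u.
Proof.
have [v vU [/= uv ->]] := ultra_embedP (ultra_class uU).
by apply/colombeau_class_eq/(ultra_coset_eq hRg hM).
Qed.

Lemma ultra_embed_inj : injective ultra_embed.
Proof.
move=> c d; have [u uU [cu ->]] := ultra_embedP c.
have [v vU [dv ->]] := ultra_embedP d => /colombeau_class_eq uv.
have cd : proj1_sig c = proj1_sig d.
  by rewrite cu dv; apply/(ultra_coset_eq hRg hM).
by case: c d cd {cu dv} => [? ?] [? ?] /= cd; exact: eq_exist.
Qed.

Lemma range_ultra_embed :
  range ultra_embed = @colombeau_class R n Omega @` ultra_moderate.
Proof.
apply/seteqP; split=> a [].
  by move=> c _ <-; have [u uU [_ ->]] := ultra_embedP c; exists u.
by move=> u uU <-; exists (ultra_class uU) => //; exact: ultra_embed_class.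
Qed.

End UltraregularSubalgebras.

Theorem proposition6 (R : realType) (n : nat) (Omega : open_domain R n)
    (Rg : set (nat -> R)) (hRg : regular_set Rg)
    (M : nat -> R) (hM : weight_sequence M) :
  (forall f, @ultraregular R n Omega M Rg f -> moderate f) /\
  differential_subalgebra (@mod_partial R n Omega)
    [set u : moderate_family Omega | ultraregular M Rg (mod_val u)] /\
  exists iota : @ultra_colombeau R n Omega M Rg -> colombeau Omega,
    [/\ forall (u : moderate_family Omega) (uU : ultraregular M Rg (mod_val u)),
          iota (ultra_class uU) = colombeau_class u,
        injective iota &
        differential_subalgebra (@colombeau_partial R n Omega) (range iota)].
Proof.
split; first by move=> f; exact: ultraregular_moderate hM f.
split; first exact: (ultra_moderate_subalgebra hRg hM).
exists (ultra_embed hM); split.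
- exact: ultra_embed_class hRg hM.
- exact: ultra_embed_inj hRg hM.
- rewrite range_ultra_embed//; apply: colombeau_class_subalgebra.
  exact: (ultra_moderate_subalgebra hRg hM).
Qed.
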